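(* Let $r\ge 2$ be an integer, $p\in[1,\infty]$ and $q\in(1,\infty)$. Let $\{A_i\in\mathcal{B}_r(\Omega_i)\}_{i=1}^\infty$ be a sequence of $r$-th order multi-$P$-operators such that $\sup_i\|A_i\|_{p,\ldots,p\to q}<\infty$, and suppose that it is action convergent to a multi-$P$-operator $A\in\mathcal{B}_r(\Omega)$. If $A_i$ is symmetric for every $i$, then $A$ is also symmetric.
   Context: An $r$-th order multi-$P$-operator acting on a probability space $(\Omega,\mathcal{F},\mathbb{P})$ is a multi-linear operator $A:L^\infty(\Omega)^{r-1}\to L^1(\Omega)$ (real-valued functions) such that $$\|A\|_{\infty\to 1}:=\sup_{0\neq f^{(i)}\in L^\infty(\Omega)}\frac{\|A[f^{(1)},\ldots,f^{(r-1)}]\|_1}{\|f^{(1)}\|_\infty\cdots\|f^{(r-1)}\|_\infty}<\infty .$$ $\mathcal{B}_r(\Omega)$ is the set of all $r$-th order multi-$P$-operators acting on $\Omega$. For $p,q\in[1,\infty]$, $$\|A\|_{p,\ldots,p\to q}:=\sup_{0\neq f^{(i)}\in L^\infty(\Omega)}\frac{\|A[f^{(1)},\ldots,f^{(r-1)}]\|_q}{\|f^{(1)}\|_p\cdots\|f^{(r-1)}\|_p}.$$ $A\in\mathcal{B}_r(\Omega)$ is symmetric if $\mathbb{E}[A[v_1,\ldots,v_{r-1}]v_r]=\mathbb{E}[A[v_{\pi(1)},\ldots,v_{\pi(r-1)}]v_{\pi(r)}]$ for all $v_1,\ldots,v_r\in L^\infty(\Omega)$ and every permutation $\pi$ of $\{1,\ldots,r\}$.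 $L^\infty_{[-1,1]}(\Omega)$ denotes the functions in $L^\infty(\Omega)$ with values in $[-1,1]$ almost everywhere, and $\mathcal{L}(\cdot)$ denotes the law of a random vector. For an integer $k\ge1$ the $k$-profile $\mathcal{S}_k(A)\subset\mathcal{P}(\mathbb{R}^{rk})$ is the set of all laws $$\mathcal{L}\big(f_1^{(1)},\ldots,f_1^{(r-1)},A[f_1^{(1)},\ldots,f_1^{(r-1)}],\ldots,f_k^{(1)},\ldots,f_k^{(r-1)},A[f_k^{(1)},\ldots,f_k^{(r-1)}]\big)$$ with all $f^{(j)}_i\in L^\infty_{[-1,1]}(\Omega)$. $d_{\mathcal{LP}}$ is the Lévy–Prokhorov metric on Borel probability measures on Euclidean space (with Euclidean neighbourhoods), and $d_H(X,Y)=\max\{\sup_{x\in X}\inf_{y\in Y}d_{\mathcal{LP}}(x,y),\sup_{y\in Y}\inf_{x\in X}d_{\mathcal{LP}}(x,y)\}$ for sets $X,Y$ of probability measures. The action convergence (pseudo-)metric is $d_M(A,B)=\sum_{k\ge1}2^{-k}d_H(\mathcal{S}_k(A),\mathcal{S}_k(B))$. A sequence $(A_i)$ is action convergent to $A$ if it is Cauchy in $d_M$ and $d_H(\mathcal{S}_k(A_i),\mathcal{S}_k(A))\to0$ for every $k\geq 1$ (equivalently $d_M(A_i,A)\to0$). *)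

(* Defs.v *)
From HB Require Import structures.
From mathcomp Require Import all_boot all_order all_algebra perm.
From mathcomp Require Import all_classical all_reals all_analysis.

Set Implicit Arguments.
Unset Strict Implicit.
Unset Printing Implicit Defensive.

Import Order.TTheory GRing.Theory Num.Theory.
Import numFieldNormedType.Exports.

Local Open Scope classical_set_scope.
Local Open Scope ring_scope.

(* Elements of L^oo and L^1 are represented by measurable functions with finite
   norm (the library's LfunType); identities between them are stated almost
   everywhere instead of in the quotient. *)
Notation Linf P := (LfunType P (leey 1%E)).
Notation L1 P := (LfunType P (lexx 1%E)).

Section MultiPOperators.
Context (R : realType) (r : nat).
Context d (T : measurableType d) (P : probability T R).
Implicit Types (A : ('I_r.-1 -> Linf P) -> L1 P) (f g : 'I_r.-1 -> Linf P).

(* Together, [ae_compatible] and [multilinear] say that A descends to a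
   multilinear map between the spaces of a.e. classes. *)
Definition ae_compatible A :=
  forall f g, (forall i, f i = g i %[ae P]) -> A f = A g %[ae P].

Definition multilinear A :=
  forall f (i : 'I_r.-1) (a : R) (u v : Linf P),
    let A_i (w : Linf P) : L1 P := A (dfwith f i w) in
    A_i (a *: u + v) = (a *: A_i u + A_i v : L1 P) %[ae P].

(* The norm ||A||_{p,...,p -> q}, possibly +oo. *)
Definition opnorm (p q : \bar R) A : \bar R :=
  ereal_sup [set ('N[P]_q[EFin \o A f] /
                  \prod_(i < r.-1) 'N[P]_p[EFin \o f i])%E |
             f in [set f : 'I_r.-1 -> Linf P | forall i, ~ (f i = cst 0 %[ae P])]].

End MultiPOperators.

(* For the order r >= 1, operators have r.-1 arguments and 'I_r.-1.+1 is 'I_r. *)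
Record multiPop (R : realType) (r : nat) d (T : measurableType d)
    (P : probability T R) := MultiPop {
  multiPop_fun :> ('I_r.-1 -> Linf P) -> L1 P ;
  multiPop_ae : ae_compatible multiPop_fun ;
  multiPop_linear : multilinear multiPop_fun ;
  multiPop_bounded : (opnorm +oo 1 multiPop_fun < +oo)%E }.

Section Symmetric.
Context (R : realType) (r : nat).
Context d (T : measurableType d) (P : probability T R).

(* E[A[v_1, ..., v_{r-1}] v_r]. *)
Definition multiPform (A : multiPop r P) (v : 'I_r.-1.+1 -> Linf P) : \bar R :=
  'E_P[fun x => A (fun i => v (lift ord_max i)) x * v ord_max x].

Definition symmetric_multiPop (A : multiPop r P) :=
  forall (v : 'I_r.-1.+1 -> Linf P) (s : {perm 'I_r.-1.+1}),
    multiPform A v = multiPform A (v \o s).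

End Symmetric.

Section Profile.
Context (R : realType) (r : nat).
Context d (T : measurableType d) (P : probability T R).
Variables (A : multiPop r P) (k : nat).

(* Row i is (f_i^(1), ..., f_i^(r-1), A[f_i^(1), ..., f_i^(r-1)]) at x, and
   [mxvec] concatenates the rows. *)
Definition profile_vector (f : 'I_k -> 'I_r.-1 -> Linf P) (x : T) :
    (k * r.-1.+1).-tuple R :=
  [tuple mxvec (\matrix_(i < k, j < r.-1.+1)
    if unlift ord_max j is Some j' then f i j' x else A (f i) x) 0 l
  | l < k * r.-1.+1].

Lemma measurable_profile_vector f : measurable_fun setT (profile_vector f).
Proof.
apply/measurable_fun_tnthP => l; case/mxvec_indexP: l => i j.
rewrite (_ : _ \o _ = fun x =>
  if unlift ord_max j is Some j' then f i j' x else A (f i) x).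
  by case: unliftP => [j' _|_]; exact: measurable_funPT.
by apply/funext => x /=; rewrite tnth_mktuple mxvecE mxE.
Qed.

HB.instance Definition _ f :=
  isMeasurableFun.Build _ _ _ _ (profile_vector f) (measurable_profile_vector f).

Definition profile : set (probability ((k * r.-1.+1).-tuple R) R) :=
  [set (distribution P (profile_vector f) : probability _ R) | f in
    [set f : 'I_k -> 'I_r.-1 -> Linf P |
      forall i j, \forall x \ae P, -1 <= f i j x <= 1]].

End Profile.
Arguments profile {R r d T P} A k _.

(* R^n is n.-tuple R: its product sigma-algebra is the Borel one. Distances are
   valued in \bar R, so that infima and suprema are total. *)
Section Metrics.
Context (R : realType) (n : nat).
Implicit Types (x y : n.-tuple R) (B : set (n.-tuple R)).
Implicit Types (mu nu : probability (n.-tuple R) R).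

Definition eucl_dist x y : R :=
  Num.sqrt (\sum_(i < n) (tnth x i - tnth y i) ^+ 2).

Definition eucl_nbhd (e : R) B := [set x | exists2 y, B y & eucl_dist x y < e].

Definition dLP mu nu : \bar R :=
  ereal_inf [set e%:E | e in [set e : R | 0 < e /\
    forall B, measurable B ->
      (mu B <= nu (eucl_nbhd e B) + e%:E /\
       nu B <= mu (eucl_nbhd e B) + e%:E)%E]].

Definition dH (X Y : set (probability (n.-tuple R) R)) : \bar R :=
  maxe (ereal_sup [set ereal_inf [set dLP x y | y in Y] | x in X])
       (ereal_sup [set ereal_inf [set dLP x y | x in X] | y in Y]).

End Metrics.

Definition dM (R : realType) (r : nat)
    d1 (T1 : measurableType d1) (P1 : probability T1 R) (A : multiPop r P1)
    d2 (T2 : measurableType d2) (P2 : probability T2 R) (B : multiPop r P2) :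
    \bar R :=
  (\sum_(1 <= k <oo) (2 ^- k)%:E * dH (profile A k) (profile B k))%E.

Section ActionConvergence.
Context (R : realType) (r : nat).
Context (d : nat -> measure_display) (T : forall i, measurableType (d i)).
Context (P : forall i, probability (T i) R) (A : forall i, multiPop r (P i)).

Definition dM_cauchy :=
  forall e : R, 0 < e -> exists N : nat, forall i j : nat,
    (N <= i)%N -> (N <= j)%N -> (dM (A i) (A j) < e%:E)%E.

Definition action_convergent
    d' (T' : measurableType d') (P' : probability T' R) (B : multiPop r P') :=
  dM_cauchy /\
  forall k : nat, (1 <= k)%N ->
    dH (profile (A i) k) (profile B k) @[i --> \oo] --> 0%E.

End ActionConvergence.

(* Main.v *)
(* Let F_A(v) = E[A[v_1, ..., v_{r-1}] v_r]. After scaling, |v_j| <= 1. The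
   3-profile of A contains the law of the rows (v_j)_{j<r}, (v_{s j})_{j<r} and
   the constant row v_r, together with the values of A on them, so for large i
   some rows of A_i have a law that is Levy-Prokhorov close to it. A bounded
   Lipschitz function has close integrals under close laws. The L^q bound with
   q > 1 makes the values of A_i uniformly integrable, so the products
   A_i[row] * coordinate, once truncated at a high level K, have expectations
   close to F_A(v) and F_A(v o s). The arguments of the second row of A_i agree
   with the permuted first row only up to an L^1-small error, which need not be
   small in L^p when p is infinite; symmetry of A_i moves such an error w to the
   last slot, where E[A_i[...] w] is small because w is bounded and L^1-small. *)
Require Import Defs.
From mathcomp Require Import all_boot all_order all_algebra.
From mathcomp Require Import all_classical all_reals all_analysis.
From mathcomp Require Import ess_sup_inf measurable_realfun perm ring lra.

Set Implicit Arguments.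
Unset Strict Implicit.
Unset Printing Implicit Defensive.

Import Order.TTheory GRing.Theory Num.Theory.
Import numFieldNormedType.Exports.

Local Open Scope classical_set_scope.
Local Open Scope ring_scope.

(** * Euclidean distance on tuples and measurability of neighbourhoods *)

Section EuclideanNeighbourhoods.
Context (R : realType) (n : nat).
Implicit Types (x y : n.-tuple R) (B U : set (n.-tuple R)).

Lemma ler_eucl_dist x y i : `|tnth x i - tnth y i| <= eucl_dist x y.
Proof.
rewrite /eucl_dist -sqrtr_sqr ler_sqrt; last by apply: sumr_ge0 => j _; exact: sqr_ge0.
by rewrite (bigD1 i)//= lerDl sumr_ge0// => j _; exact: sqr_ge0.
Qed.

(** When each coordinate moves by less than c <= 1, each squared difference grows by at most (2e +
    1)c, so the squared distance stays below e^2 for small c. *)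
Lemma eucl_dist_lt_open x y (e : R) : eucl_dist x y < e ->
  exists2 dl : R, 0 < dl & forall x', (forall i, `|tnth x' i - tnth x i| < dl) ->
    eucl_dist x' y < e.
Proof.
move=> xye.
have e0 : 0 < e by exact: le_lt_trans (sqrtr_ge0 _) xye.
pose S z := \sum_(i < n) (tnth z i - tnth y i) ^+ 2.
have S_ge0 z : 0 <= S z by apply: sumr_ge0 => j _; exact: sqr_ge0.
have distE z : (eucl_dist z y < e) = (S z < e ^+ 2).
  by rewrite -(ltr_sqrt (S z)) ?exprn_gt0// sqrtr_sqr gtr0_norm.
have c0 : 0 < e ^+ 2 - S x by rewrite subr_gt0 -distE.
(* The summand 1 keeps [M] positive when n = 0 and makes the final inequality strict. *)
pose M := n%:R * (2 * e + 1) + 1.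
have M0 : 0 < M by rewrite ltr_wpDl// mulr_ge0// ?ler0n// addr_ge0// mulr_ge0// ltW.
have dl0 : 0 < (e ^+ 2 - S x) / M by rewrite divr_gt0.
exists (Num.min 1 ((e ^+ 2 - S x) / M)); first by rewrite lt_min ltr01.
move=> x' x'x; rewrite distE.
have Sx' : S x' <= S x + n%:R * (2 * e + 1) * ((e ^+ 2 - S x) / M).
  rewrite -mulrA mulr_natl -[n in _ *+ n]card_ord -sumr_const -big_split/=.
  apply: ler_sum => i _.
  have := x'x i; rewrite lt_min => /andP[h1 hd].
  have := le_lt_trans (ler_eucl_dist x y i) xye.
  move: h1 hd; move: (_ / M) dl0 (tnth x' i) (tnth x i) (tnth y i) => c c0' a b z.
  rewrite !ltr_norml => /andP[? ?] /andP[? ?] /andP[? ?].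
  have : (a - b) ^+ 2 <= c.
    have [ab|ab] := leP 0 (a - b); nra.
  have : 2 * (a - b) * (b - z) <= 2 * e * c.
    have [ab|ab] := leP 0 (a - b); nra.
  move: e0; nra.
rewrite (le_lt_trans Sx')// -ltrBrDl mulrCA -[ltRHS]mulr1 ltr_pM2l//.
by rewrite ltr_pdivrMr// mul1r /M ltrDl.
Qed.

(* The product sigma-algebra contains the open sets: U is the union of the
   countably many rational cubes that it contains. *)
Lemma measurable_coord_open U :
    (forall x, U x -> exists2 dl : R, 0 < dl &
      forall x', (forall i, `|tnth x' i - tnth x i| < dl) -> U x') ->
  measurable U.
Proof.
move=> openU.
pose cube (c : n.-tuple rat * nat) : set (n.-tuple R) :=
  \bigcap_(i in [set: 'I_n])
    (@tnth _ R ^~ i) @^-1` ball (ratr (tnth c.1 i) : R) c.2.+1%:R^-1.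
have mcube c : measurable (cube c).
  apply: fin_bigcap_measurable => [|i _]; first exact: finite_finset.
  rewrite -[X in measurable X]setTI.
  by apply: measurable_tnth => //; exact: measurable_ball.
have -> : U = \bigcup_(c : n.-tuple rat * nat)
    (if pselect (cube c `<=` U) then cube c else set0).
  apply/seteqP; split=> [x Ux|x [c _]]; last by case: pselect => // cU /cU.
  have [dl dl0 Udl] := openU x Ux.
  (* Half of [dl] suffices as radius: [x] and any other point of the cube are both within the radius
     of its centre. *)
  have [k _ /(_ _ (leqnn _)) kdl] :=
    near_infty_natSinv_lt (PosNum (divr_gt0 dl0 (ltr0n R 2))).
  have /choice[c xc] i : exists q : rat, `|ratr q - tnth x i| < k.+1%:R^-1.
    have : tnth x i < tnth x i + k.+1%:R^-1 by rewrite ltrDl invr_gt0 ltr0n.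
    case/rat_in_itvoo => q; rewrite in_itv/= => /andP[xq qx].
    by exists q; rewrite gtr0_norm ?subr_gt0// ltrBlDl.
  exists ([tuple c i | i < n], k) => //.
  case: pselect => [_ i _|[]] /=; first by rewrite tnth_mktuple /ball/=.
  move=> y /= cy; apply: Udl => i.
  have := cy i I; rewrite /= tnth_mktuple /ball/= => yi.
  rewrite -(subrKA (ratr (c i))) (le_lt_trans (ler_normD _ _))//.
  by rewrite [ltRHS]splitr ltrD ?(lt_trans _ kdl)// distrC.
apply: countable_bigcupT_measurable => [|c]; first exact: countableP.
by case: pselect => ?; [exact: mcube|exact: measurable0].
Qed.

Lemma measurable_eucl_nbhd (e : R) B : measurable (eucl_nbhd e B).
Proof.
apply: measurable_coord_open => x [y By /eucl_dist_lt_open[dl dl0 xdl]].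
by exists dl => // x' /xdl x'y; exists y.
Qed.

End EuclideanNeighbourhoods.

(** * Integrals of Lipschitz functions under Levy-Prokhorov close laws *)

Section TailComparison.
Context d (T : measurableType d) d' (T' : measurableType d') (R : realType).
Context (P : probability T R) (P' : probability T' R).

(** Layer-cake formula: a nonnegative variable has the integral of its tail over [0, +oo[ as
    expectation. The shifted tail is the tail of X' + dl, and the error e is charged on [0, M] only,
    since the tail of X vanishes beyond M. *)
Lemma expectation_le_ccdf_shift (X : {RV P >-> R}) (X' : {RV P' >-> R})
    (M dl e : R) :
    0 <= dl -> 0 <= e -> (forall x, 0 <= X x <= M) -> (forall x, 0 <= X' x) ->
    (forall t, ccdf X t <= ccdf X' (t - dl)%R + e%:E)%E ->
  ('E_P[X] <= 'E_P'[X'] + (dl + M * e)%:E)%E.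
Proof.
move=> dl0 e0 XM X'0 XX'.
have M0 : 0 <= M by case/andP: (XM point) => /le_trans; apply.
pose Y' : {RV P' >-> R} := (X' \+ cst dl)%R.
have Y'0 x : 0 <= Y' x by rewrite addr_ge0// X'0.
have EY' : ('E_P'[Y'] = 'E_P'[X'] + dl%:E)%E.
  rewrite unlock; under eq_integral do rewrite EFinD.
  rewrite ge0_integralD//=.
  - by rewrite integral_cst//= probability_setT mule1.
  - by move=> x _; rewrite lee_fin X'0.
  - by apply/measurable_EFinP.
have ccdfY' t : ccdf X' (t - dl) = ccdf Y' t.
  rewrite /ccdf /distribution /pushforward/=; congr (P' _).
  by apply/seteqP; split=> x /=; rewrite !in_itv/= !andbT ltrBlDr.
have MeE : (\int[lebesgue_measure]_(t in `[0%R, +oo[) (e * \1_`[0, M] t)%:E)%E =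
    (M * e)%:E.
  under eq_integral do rewrite EFinM.
  rewrite ge0_integralZl//; last first.
    by apply/measurable_EFinP; apply: measurable_funTS; exact: measurable_indic.
  rewrite integral_indic//= setIidl.
    rewrite lebesgue_measure_itv/= lte_fin.
    by case: ltgtP M0 => // [M0 _|<- _]; rewrite ?EFinB/= ?sube0 ?mule0 ?mul0r// muleC.
  by move=> t /=; rewrite !in_itv/= => /andP[->].
rewrite EFinD addeA -EY' !ge0_expectation_ccdf//; last by move=> x; case/andP: (XM x).
rewrite -MeE -ge0_integralD//.
- apply: ge0_le_integral => //.
  + by apply: measurable_funTS; exact: ccdf_measurable.
  + apply: emeasurable_funD; first by apply: measurable_funTS; exact: ccdf_measurable.
    exact/measurable_EFinP/measurable_funM.
  + move=> t /=; rewrite in_itv/= andbT => t0.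
    have [tM|Mt] := leP t M.
      rewrite indicE mem_set/= ?in_itv/= ?t0// mulr1 -ccdfY'; exact: XX'.
    rewrite (_ : ccdf X t = 0%E) ?adde_ge0// ?lee_fin ?mulr_ge0//.
    rewrite /ccdf /distribution /pushforward/= (_ : _ @^-1` _ = set0) ?measure0//.
    apply/seteqP; split=> x //=; rewrite in_itv/= andbT ltNge.
    by case/andP: (XM x) => _ /le_trans -> //; exact: ltW.
- by apply: measurable_funTS; exact: ccdf_measurable.
- by move=> t _; rewrite lee_fin mulr_ge0.
- exact/measurable_EFinP/measurable_funM.
Qed.

End TailComparison.

Lemma integrable_ae_bounded d (T : measurableType d) (R : realType)
    (P : probability T R) (f : T -> R) (M : R) :
  measurable_fun setT f -> (\forall x \ae P, `|f x| <= M) ->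
  P.-integrable setT (EFin \o f).
Proof.
move=> mf fM; apply/integrableP; split; first exact/measurable_EFinP.
apply: (@le_lt_trans _ _ (\int[P]_x `|M|%:E)%E).
  apply: ae_ge0_le_integral => //.
  - exact/measurableT_comp/measurable_EFinP.
  - apply: filterS fM => x fxM _ /=; rewrite lee_fin (le_trans fxM)//.
    exact: ler_norm.
by rewrite integral_cst//= probability_setT mule1 ltry.
Qed.

Lemma eucl_distC (R : realType) n (x y : n.-tuple R) :
  eucl_dist x y = eucl_dist y x.
Proof. by rewrite /eucl_dist; under eq_bigr do rewrite -sqrrN opprB. Qed.

Section LevyProkhorov.
Context d (T : measurableType d) d' (T' : measurableType d') (R : realType).
Context (P : probability T R) (P' : probability T' R) (n : nat).
Context (X : {RV P >-> n.-tuple R}) (X' : {RV P' >-> n.-tuple R}).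

(** The hypothesis is applied to the superlevel sets {g > t}: since g is L-Lipschitz, the
    e-neighbourhood of such a set lies in {g > t - L e}. This is a tail comparison with shift L
    e. *)
Lemma eucl_nbhd_Rintegral_le (g : n.-tuple R -> R) (L M e : R) :
    measurable_fun setT g -> (forall x, 0 <= g x <= M) -> 0 <= L ->
    (forall x y, g x - g y <= L * eucl_dist x y) -> 0 < e ->
    (forall B, measurable B ->
      (distribution P X B <= distribution P' X' (eucl_nbhd e B) + e%:E)%E) ->
  \int[P]_x g (X x) <= \int[P']_x g (X' x) + (L + M) * e.
Proof.
move=> mg gM L0 lipg e0 XX'.
pose gX : {RV P >-> R} := mfun_Sub (mem_set (measurableT_comp mg (measurable_funPT X))).
pose gX' : {RV P' >-> R} := mfun_Sub (mem_set (measurableT_comp mg (measurable_funPT X'))).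
have intgX : P.-integrable setT (EFin \o gX).
  apply: (@integrable_ae_bounded _ _ _ _ _ M); first exact: measurable_funPT.
  by apply: aeW => x; case/andP: (gM (X x)) => g0 ?; rewrite ger0_norm.
have intgX' : P'.-integrable setT (EFin \o gX').
  apply: (@integrable_ae_bounded _ _ _ _ _ M); first exact: measurable_funPT.
  by apply: aeW => x; case/andP: (gM (X' x)) => g0 ?; rewrite ger0_norm.
suff : ('E_P[gX] <= 'E_P'[gX'] + (L * e + M * e)%:E)%E.
  rewrite unlock -mulrDl -lee_fin EFinD !fineK//; exact: integrable_fin_num.
apply: expectation_le_ccdf_shift => [||x|x|t].
- exact/mulr_ge0/ltW.
- exact: ltW.
- exact: gM.
- by case/andP: (gM (X' x)).
have mgt s : measurable [set y | g y \in `]s, +oo[].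
  rewrite -[X in measurable X]setTI.
  exact: mg measurableT _ (measurable_itv `]s, +oo[).
apply: (le_trans (XX' _ (mgt t))); apply: leeD2r.
rewrite /distribution /pushforward/= le_measure// ?inE.
- rewrite -[X in measurable X]setTI; apply: measurable_funPT => //.
  exact: measurable_eucl_nbhd.
- by rewrite -[X in measurable X]setTI; apply: measurable_funPT => //; exact: mgt.
move=> y [z /=]; rewrite /pushforward/= !in_itv/= !andbT => tz yz.
rewrite ltrBlDr (lt_le_trans tz)// -lerBlDl (le_trans (lipg _ _))//.
by rewrite ler_wpM2l// eucl_distC ltW.
Qed.

End LevyProkhorov.

Section LevyProkhorovDistance.
Context d (T : measurableType d) d' (T' : measurableType d') (R : realType).
Context (P : probability T R) (P' : probability T' R) (n : nat).
Context (X : {RV P >-> n.-tuple R}) (X' : {RV P' >-> n.-tuple R}).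
Context (g : n.-tuple R -> R) (L M e : R).
Hypotheses (mg : measurable_fun setT g) (gM : forall x, 0 <= g x <= M).
Hypotheses (L0 : 0 <= L) (lipg : forall x y, g x - g y <= L * eucl_dist x y).
Hypothesis XX'e : (dLP (distribution P X) (distribution P' X') < e%:E)%E.

Lemma dLP_lt_Rintegral :
  `|\int[P]_x g (X x) - \int[P']_x g (X' x)| <= (L + M) * e.
Proof.
have M0 : 0 <= M by case/andP: (gM point) => /le_trans; apply.
(* The infimum need not be attained, so an admissible radius [s] below [e] is used; its two
   inequalities give the two signs. *)
have [_ [s [s0 XX's] <-]] := ereal_inf_lt XX'e; rewrite lte_fin => se.
have LMs : (L + M) * s <= (L + M) * e by rewrite ler_wpM2l ?addr_ge0// ltW.
have le1 : \int[P]_x g (X x) <= \int[P']_x g (X' x) + (L + M) * s.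
  by apply: eucl_nbhd_Rintegral_le => // B /XX's[].
have le2 : \int[P']_x g (X' x) <= \int[P]_x g (X x) + (L + M) * s.
  by apply: eucl_nbhd_Rintegral_le => // B /XX's[].
by rewrite ler_norml; apply/andP; split; lra.
Qed.

End LevyProkhorovDistance.

(** * Truncation of real numbers *)

Section Clip.
Context (R : realType).
Implicit Types (K x y : R).

(** Clipping, unlike multiplication by an indicator, is 1-Lipschitz, as the comparison of laws
    requires. *)
Definition clip K x := Num.max (- K) (Num.min x K).

Lemma ler_norm_clip K x : 0 <= K -> `|clip K x| <= K.
Proof.
move=> K0; rewrite ler_norml /clip le_max lexx/= ge_max ge_min lexx orbT andbT.
by rewrite ge0_cp.
Qed.

Lemma clip_id K x : `|x| <= K -> clip K x = x.
Proof.
by rewrite ler_norml => /andP[Kx xK]; rewrite /clip min_l// max_r.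
Qed.

Lemma ler_dist_clip K x y : 0 <= K -> `|clip K x - clip K y| <= `|x - y|.
Proof.
move=> K0; rewrite /clip !maxEle !minEle ler_norml.
have := ler_norm (x - y); have := ler_norm (y - x); rewrite distrC.
by case: ifPn; case: ifPn; case: ifPn; case: ifPn; rewrite -?ltNge;
  move=> *; apply/andP; split; lra.
Qed.

Lemma ler_dist_clipl K x : 0 <= K -> `|x - clip K x| <= `|x|.
Proof.
move=> K0; rewrite /clip !maxEle !minEle ler_norml.
have := ler_norm x; have := ler_norm (- x); rewrite normrN.
by case: ifPn; case: ifPn; rewrite -?ltNge; move=> *; apply/andP; split; lra.
Qed.

Lemma measurable_clip K : measurable_fun setT (clip K).
Proof. by apply: measurable_maxr => //; exact: measurable_minr. Qed.

(** Above level K the factor |x|^(q - 1) is at least K^(q - 1). *)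
Lemma ler_norm_powR K q x : 0 < K -> 1 < q -> K < `|x| ->
  `|x| <= `|x| `^ q / K `^ (q - 1).
Proof.
move=> K0 q1 Kx; have x0 : 0 < `|x| by exact: lt_trans Kx.
have -> : `|x| `^ q = `|x| * `|x| `^ (q - 1).
  by rewrite -{2}(powRr1 (normr_ge0 x)) -powRD ?(gt_eqF x0) ?implybT// addrC subrK.
rewrite ler_pdivlMr ?powR_gt0// ler_wpM2l// ge0_ler_powR ?nnegrE//; lra.
Qed.

Lemma ler_dist_clip_powR K q x : 0 < K -> 1 < q ->
  `|x - clip K x| <= `|x| `^ q / K `^ (q - 1).
Proof.
move=> K0 q1; have [xK|Kx] := leP `|x| K.
  by rewrite clip_id// subrr normr0 mulr_ge0 ?invr_ge0 ?powR_ge0.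
exact: le_trans (ler_dist_clipl _ (ltW K0)) (ler_norm_powR K0 q1 Kx).
Qed.

Lemma ler_norm_powRD K q x : 0 < K -> 1 < q ->
  `|x| <= K + `|x| `^ q / K `^ (q - 1).
Proof.
move=> K0 q1; have [xK|Kx] := leP `|x| K.
  by rewrite ler_wpDr// mulr_ge0 ?invr_ge0 ?powR_ge0.
by rewrite ler_wpDl ?(ltW K0)// ler_norm_powR.
Qed.

End Clip.

(** * Almost everywhere estimates, truncation errors and uniform integrability *)

Section Integrals.
Context d (T : measurableType d) (R : realType) (P : probability T R).
Implicit Types (f g X Y w : T -> R).

Lemma ae_le_integrable f g : measurable_fun setT f ->
  P.-integrable setT (EFin \o g) -> (\forall x \ae P, `|f x| <= `|g x|) ->
  P.-integrable setT (EFin \o f).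
Proof.
move=> mf /integrableP[mg intg] fg.
apply/integrableP; split; first exact/measurable_EFinP.
apply: le_lt_trans intg; apply: ae_ge0_le_integral => //.
- by apply: measurableT_comp => //; exact/measurable_EFinP.
- exact: measurableT_comp.
- by apply: filterS fg => x fgx _.
Qed.

Lemma ae_eq_Rintegral f g : measurable_fun setT f -> measurable_fun setT g ->
  (\forall x \ae P, f x = g x) -> \int[P]_x f x = \int[P]_x g x.
Proof.
move=> mf mg fg; congr fine; apply: ae_eq_integral => //; [exact/measurable_EFinP..|].
by apply: filterS fg => x fgx _ /=; rewrite fgx.
Qed.

Lemma ae_le_Rintegral f g : P.-integrable setT (EFin \o f) ->
  P.-integrable setT (EFin \o g) -> (\forall x \ae P, f x <= g x) ->
  \int[P]_x f x <= \int[P]_x g x.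
Proof.
move=> intf intg fg.
have mf : measurable_fun setT f by apply/measurable_EFinP; case/integrableP: intf.
have mg : measurable_fun setT g by apply/measurable_EFinP; case/integrableP: intg.
(* The minimum equals [f] almost everywhere and is below [g] everywhere, which reduces the claim to
   the pointwise comparison. *)
have mfg : measurable_fun setT (f \min g) by exact: measurable_minr.
have intfg : P.-integrable setT (EFin \o (f \min g)).
  apply: ae_le_integrable intf _ => //.
  by apply: filterS fg => x fgx; rewrite /= min_l.
rewrite (@ae_eq_Rintegral f (f \min g))//; last first.
  by apply: filterS fg => x fgx; rewrite /= min_l.
by apply: le_Rintegral => // x _ /=; rewrite ge_min lexx orbT.
Qed.

Lemma ae_integrableM X Y (c : R) : P.-integrable setT (EFin \o X) ->
  measurable_fun setT Y -> (\forall x \ae P, `|Y x| <= c) ->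
  P.-integrable setT (EFin \o (fun x => X x * Y x)).
Proof.
move=> intX mY Yc.
have mX : measurable_fun setT X by apply/measurable_EFinP; case/integrableP: intX.
apply: (@ae_le_integrable _ (fun x => c * X x)); first exact: measurable_funM.
  exact: (integrableZl measurableT c intX).
apply: filterS Yc => x Yxc; rewrite !normrM mulrC ler_wpM2r//.
exact: le_trans (ler_norm _).
Qed.

Lemma integrable_clip K X : 0 <= K -> P.-integrable setT (EFin \o X) ->
  P.-integrable setT (EFin \o (fun x => clip K (X x))).
Proof.
move=> K0 intX.
have mX : measurable_fun setT X by apply/measurable_EFinP; case/integrableP: intX.
apply: (@integrable_ae_bounded _ _ _ _ _ K).
  by apply: measurableT_comp => //; exact: measurable_clip.
by apply: aeW => x; exact: ler_norm_clip.
Qed.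

(** Clipping Y at 1 changes nothing almost everywhere, but turns the integrand into a function of
    (X, Y) that is bounded and Lipschitz on the whole plane. *)
Lemma Rintegral_clip_dist K X Y : 0 <= K -> P.-integrable setT (EFin \o X) ->
  measurable_fun setT Y -> (\forall x \ae P, `|Y x| <= 1) ->
  `|\int[P]_x (X x * Y x) - \int[P]_x (clip K (X x) * clip 1 (Y x))| <=
  \int[P]_x `|X x - clip K (X x)|.
Proof.
move=> K0 intX mY Y1.
have intXK := integrable_clip K0 intX.
have m1Y : measurable_fun setT (fun x => clip 1 (Y x)).
  by apply: measurableT_comp => //; exact: measurable_clip.
have Y11 : \forall x \ae P, `|clip 1 (Y x)| <= 1.
  by apply: aeW => x; exact: ler_norm_clip.
have intXY := ae_integrableM intX mY Y1.
have intXYK := ae_integrableM intXK m1Y Y11.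
rewrite -RintegralB//; apply: le_trans (le_normr_Rintegral _ _) _ => //.
  exact: (integrableB measurableT intXY intXYK).
apply: ae_le_Rintegral.
- exact: (integrable_abse (integrableB measurableT intXY intXYK)).
- exact: (integrable_abse (integrableB measurableT intX intXK)).
apply: filterS Y1 => x Y1x; rewrite (clip_id Y1x) -mulrBl normrM.
by rewrite ler_piMr.
Qed.

Context (q D : R) (X : T -> R).
Hypotheses (q1 : 1 < q) (mX : measurable_fun setT X).
Hypothesis XD : (\int[P]_x (`|X x| `^ q)%:E <= D%:E)%E.

Let integrable_powX : P.-integrable setT (EFin \o (fun x => `|X x| `^ q)).
Proof.
apply/integrableP; split.
  apply/measurable_EFinP.
  by apply: (measurableT_comp (measurable_powR _)) => //; exact: measurableT_comp.
under eq_integral do rewrite gee0_abs ?lee_fin ?powR_ge0//.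
by rewrite (le_lt_trans XD)// ltry.
Qed.

Let integrable_powXK K : P.-integrable setT (EFin \o (fun x => `|X x| `^ q / K)).
Proof. exact: (integrableZr measurableT K^-1 integrable_powX). Qed.

Let Rintegral_powXK K : 0 <= K -> \int[P]_x (`|X x| `^ q / K) <= D / K.
Proof.
move=> K0; rewrite RintegralZr// ler_wpM2r ?invr_ge0//.
by rewrite -lee_fin fineK//; exact: integrable_fin_num.
Qed.

Lemma integrable_moment : P.-integrable setT (EFin \o X).
Proof.
apply: (@le_integrable _ _ _ P _ measurableT _
    (EFin \o (fun x => 1 + `|X x| `^ q / 1 `^ (q - 1)))).
- exact/measurable_EFinP.
- move=> x _; rewrite /= lee_fin (le_trans _ (ler_norm _))//.
  exact: ler_norm_powRD.
- have int1 := finite_measure_integrable_cst P (1 : R) measurableT.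
  exact: (integrableD measurableT int1 (integrable_powXK _)).
Qed.

(** Uniform integrability: the bound depends on X only through its moment bound D. *)
Lemma Rintegral_tail_moment K : 0 < K ->
  \int[P]_x `|X x - clip K (X x)| <= D / K `^ (q - 1).
Proof.
move=> K0; have intX := integrable_moment.
apply: le_trans (Rintegral_powXK (powR_ge0 _ _)).
apply: le_Rintegral => //.
- exact: (integrable_abse (integrableB measurableT intX (integrable_clip (ltW K0) intX))).
- by move=> x _; exact: ler_dist_clip_powR.
Qed.

(** In |X| <= K + |X|^q / K^(q - 1), the first summand is paired with the L^1 norm of w and the
    second with its sup bound c. *)
Lemma Rintegral_moment_le K c w : 0 < K -> 0 <= c -> measurable_fun setT w ->
    (\forall x \ae P, `|w x| <= c) ->
  `|\int[P]_x (X x * w x)| <= K * \int[P]_x `|w x| + c * (D / K `^ (q - 1)).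
Proof.
move=> K0 c0 mw wc.
have intXw := ae_integrableM integrable_moment mw wc.
have intw := integrable_abse (integrable_ae_bounded mw wc).
have intKw := integrableZl measurableT K intw.
have intcX := integrableZl measurableT c (integrable_powXK (K `^ (q - 1))).
apply: le_trans (le_normr_Rintegral _ _) _ => //.
apply: le_trans (lerD (lexx _) (ler_wpM2l c0 (Rintegral_powXK (powR_ge0 _ _)))).
rewrite -!RintegralZl// -RintegralD//.
apply: ae_le_Rintegral; first exact: (integrable_abse intXw).
  exact: (integrableD measurableT intKw intcX).
apply: filterS wc => x wcx; rewrite normrM.
apply: le_trans (ler_wpM2r (normr_ge0 _) (ler_norm_powRD _ K0 q1)) _.
by rewrite mulrDl lerD2l mulrC ler_wpM2r// mulr_ge0 ?invr_ge0 ?powR_ge0.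
Qed.

End Integrals.

(** This serves the limit operator, whose values are only known to be integrable: dominated
    convergence gives no rate but asks for no moment. *)
Lemma cvg_Rintegral_tail d (T : measurableType d) (R : realType)
    (P : probability T R) (X : T -> R) : P.-integrable setT (EFin \o X) ->
  (\int[P]_x `|X x - clip n.+1%:R (X x)|) @[n --> \oo] --> (0 : R).
Proof.
move=> intX.
have mX : measurable_fun setT X by apply/measurable_EFinP; case/integrableP: intX.
have mX_ n : measurable_fun setT (fun x => X x - clip n.+1%:R (X x)).
  by apply: measurable_funB => //; apply: measurableT_comp => //; exact: measurable_clip.
have [|||||_ + _] := @dominated_convergence _ _ _ P _ measurableT
    (fun n x => (X x - clip n.+1%:R (X x))%:E) (cst 0%E) (fun x => `|X x|%:E).
- by move=> n; exact/measurable_EFinP.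
- by [].
- apply: aeW => x _; apply: cvg_near_cst; near=> n.
  rewrite clip_id ?subrr// (le_trans (ltW (archi_boundP (normr_ge0 (X x)))))//.
  rewrite ler_nat ltnW// ltnS; near: n; exact: nbhs_infty_ge.
- exact: (integrable_abse intX).
- by apply: aeW => x n _; rewrite lee_fin ler_dist_clipl.
under eq_fun do under eq_integral do rewrite sube0.
by move/fine_cvg.
Unshelve. all: by end_near. Qed.

(** * Moment bounds for operators and the associated multilinear form *)

Section Operators.
Context (R : realType) (r : nat).
Context d (T : measurableType d) (P : probability T R).
Implicit Types (A : multiPop r P) (f : 'I_r.-1 -> Linf P).

Lemma Linf_ae_bounded (f : Linf P) :
  exists2 c : R, 0 < c & \forall x \ae P, `|f x| <= c.
Proof.
have := @Lfunction_finite _ _ _ P _ _ f.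
rewrite /finite_norm unlock /= probability_setT lte01.
move=> /(@ess_supr_bounded _ _ _ _ (Num.norm \o f))[c fc].
exists (Num.max 1 c); first by rewrite lt_max ltr01.
by apply: filterS fc => x /= fxc; rewrite le_max fxc orbT.
Qed.

Lemma Lnorm_le1 (p : \bar R) (f : T -> R) : (1 <= p)%E -> measurable_fun setT f ->
  (\forall x \ae P, `|f x| <= 1) -> ('N[P]_p[EFin \o f] <= 1)%E.
Proof.
move=> p1 mf f1; rewrite unlock; case: p p1 => [p|_|//]; last first.
  by rewrite /= probability_setT lte01; apply/ess_supP.
rewrite lee_fin => p1; have p0 : 0 < p by lra.
rewrite -[leRHS](poweR1r p^-1) gt0_ler_poweR//.
- by rewrite invr_ge0 ltW.
- by rewrite in_itv/= leey andbT integral_ge0// => x _; exact: poweR_ge0.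
- by rewrite in_itv/= leey lee01.
rewrite -[leRHS](probability_setT P) -[leRHS]mul1e -integral_cst//.
apply: ae_ge0_le_integral => //.
- by move=> x _; exact: poweR_ge0.
- apply: measurableT_comp (measurable_poweR _) _.
  by apply: measurableT_comp => //; exact/measurable_EFinP.
- apply: filterS f1 => x fx1 _.
  rewrite poweR_EFin lee_fin (_ : 1%R = 1 `^ p); last by rewrite powR1.
  by rewrite ge0_ler_powR ?nnegrE// ltW.
Qed.

Lemma L1_integrable (f : L1 P) : P.-integrable setT (EFin \o f).
Proof. by apply/Lfun1_integrable; exact: LfunP. Qed.

(** Up to a.e. equality, slot [i] may be replaced by [-1 *: f i + f i]; linearity with coefficient
    -1 then makes the value cancel. *)
Lemma multiPop_eq0 A f i : f i = cst 0 %[ae P] -> A f = cst 0 %[ae P].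
Proof.
move=> fi0.
have := multiPop_linear A f i (-1) (f i) (f i).
have : A f = A (dfwith f i (-1 *: f i + f i)) %[ae P].
  apply: multiPop_ae => j; case: dfwithP => [|k _]; last by exact: ae_eq_refl.
  by apply: filterS fi0 => x fx0 _; rewrite /= fx0// scaleN1r addrC subrr.
rewrite /=; apply: filterS2 => x AfE Af0 _; rewrite AfE// Af0//=.
by rewrite scaleN1r addrC subrr.
Qed.

(** The supremum in [opnorm] skips tuples with a null argument, which are settled by multilinearity.
    For the others, the L^p norms are at most 1 on a probability space, so division by their product
    can only increase the L^q norm. *)
Lemma multiPop_moment A p q C f : (1 <= p)%E -> 1 < q -> 0 <= C ->
  (opnorm p q%:E A <= C%:E)%E -> (forall i, \forall x \ae P, `|f i x| <= 1) ->
  (\int[P]_x (`|A f x| `^ q)%:E <= (C `^ q)%:E)%E.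
Proof.
move=> p1 q1 C0 AC f1.
have q0 : 0 < q by lra.
have mAf : measurable_fun setT (fun x => (`|A f x| `^ q)%:E).
  apply/measurable_EFinP/(measurableT_comp (measurable_powR _)).
  exact: measurableT_comp.
have [[i fi0]|/forallNP fN0] := pselect (exists i, f i = cst 0 %[ae P]).
  rewrite (@ae_eq_integral _ _ _ _ _ (cst 0%E))// ?integral0 ?lee_fin ?powR_ge0//.
  apply: filterS (multiPop_eq0 A fi0) => x Afx0 xT.
  by rewrite Afx0//= normr0 powR0// gt_eqF.
rewrite -[leLHS](_ : 'N[P]_q%:E[EFin \o A f] `^ q = _)%E; last first.
  by rewrite poweR_Lnorm// gt_eqF.
rewrite -poweR_EFin gt0_ler_poweR//.
- exact: ltW.
- by rewrite in_itv/= leey Lnorm_ge0.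
- by rewrite in_itv/= leey lee_fin C0.
apply: le_trans AC; apply: le_trans (ereal_sup_ubound _); last by exists f.
rewrite -[leLHS]mule1; apply: lee_wpmul2l; first exact: Lnorm_ge0.
have /andP[prod_ge0 prod_le1] : (0 <= \prod_(i < r.-1) 'N[P]_p[EFin \o f i] <= 1)%E.
  apply: (big_ind (fun y : \bar R => 0 <= y <= 1)%E) => [|y z|i _].
  - by rewrite lee01 lexx.
  - move=> /andP[y0 y1] /andP[z0 z1]; rewrite mule_ge0//=.
    by rewrite -[leRHS]mule1 lee_pmul.
  - by rewrite Lnorm_ge0 Lnorm_le1.
by rewrite inve_ge1.
Qed.

(** A real-valued copy of [multiPform], so that differences and sums of forms can be estimated in
    R. *)
Definition multiRform A (v : 'I_r.-1.+1 -> Linf P) : R :=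
  \int[P]_x (A (fun i => v (lift ord_max i)) x * v ord_max x).

Lemma integrable_multiRform A (v : 'I_r.-1.+1 -> Linf P) :
  P.-integrable setT
    (EFin \o (fun x => A (fun i => v (lift ord_max i)) x * v ord_max x)).
Proof.
have [c _ vc] := Linf_ae_bounded (v ord_max).
by apply: ae_integrableM vc => //; exact: L1_integrable.
Qed.

Lemma multiPformE A v : multiPform A v = (multiRform A v)%:E.
Proof.
rewrite /multiPform unlock fineK//.
exact: (integrable_fin_num measurableT (integrable_multiRform A v)).
Qed.

(** In the last slot this is linearity of the integral; in the others it is multilinearity of A,
    valid almost everywhere. *)
Lemma multiRform_linear A (v : 'I_r.-1.+1 -> Linf P) j (a : R) (u w : Linf P) :
  multiRform A (dfwith v j (a *: u + w)) =
  a * multiRform A (dfwith v j u) + multiRform A (dfwith v j w).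
Proof.
have intA z := integrable_multiRform A (dfwith v j z).
rewrite /multiRform -RintegralZl// -RintegralD//; last first.
  exact: (integrableZl measurableT a (intA u)).
apply: ae_eq_Rintegral.
- exact: measurable_funM.
- by apply: measurable_funD; [apply: measurable_funM => //|]; exact: measurable_funM.
case: (unliftP ord_max j) => [i|] ->; last first.
  have vlift z : (fun i => dfwith v ord_max z (lift ord_max i)) =
      (fun i => v (lift ord_max i)).
    by apply/funext => i; rewrite dfwithout// neq_lift.
  by apply: aeW => x; rewrite !vlift !dfwithin /= mulrDr mulrCA.
have vlift z : (fun k => dfwith v (lift ord_max i) z (lift ord_max k)) =
    dfwith (fun k => v (lift ord_max k)) i z.
  apply/funext => k; have [<-|ik] := eqVneq i k; first by rewrite !dfwithin.
  by rewrite !dfwithout// (inj_eq lift_inj).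
have := multiPop_linear A (fun k => v (lift ord_max k)) i a u w.
rewrite !vlift /= !dfwithout 1?eq_sym ?neq_lift//.
by apply: filterS => x -> //=; rewrite mulrDl mulrA.
Qed.

End Operators.

(** * Slot-by-slot replacement and perturbation of the form *)

Section Mix.
Context (N : nat) (V : Type).
Implicit Types (u w : 'I_N -> V).

Definition mix m u w : 'I_N -> V := fun i => if (i < m)%N then w i else u i.

Lemma mix0 u w : mix 0 u w = u.
Proof. by apply/funext => i. Qed.

Lemma mix_full u w : mix N u w = w.
Proof. by apply/funext => i; rewrite /mix ltn_ord. Qed.

(** Writing slot [m] explicitly gives hybrid [m] the same [dfwith] shape as hybrid [m.+1], so that
    linearity in that slot applies to both. *)
Lemma mix_dfwith m (mN : (m < N)%N) u w :
  mix m u w = dfwith (mix m u w) (Ordinal mN) (u (Ordinal mN)).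
Proof.
by apply/funext => i; case: dfwithP => [|//]; rewrite /mix /= ltnn.
Qed.

Lemma mixS m (mN : (m < N)%N) u w :
  mix m.+1 u w = dfwith (mix m u w) (Ordinal mN) (w (Ordinal mN)).
Proof.
apply/funext => i; case: dfwithP => [|j /eqP mj]; first by rewrite /mix ltnSn.
rewrite /mix ltnS leq_eqVlt; case: eqP => [jm|//].
by case: mj; exact/val_inj.
Qed.

End Mix.

Section FormBounds.
Context (R : realType) (r : nat).
Context d (T : measurableType d) (P : probability T R).
Implicit Types (A : multiPop r P) (v u w : 'I_r.-1.+1 -> Linf P).

Lemma multiRformZ A v (c : R) :
  multiRform A (fun i => c *: v i) = c ^+ r.-1.+1 * multiRform A v.
Proof.
(* Linearity at 0 = 1 * 0 + 0 says that the value equals twice itself. *)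
have form0 u j : multiRform A (dfwith u j 0) = 0.
  have := multiRform_linear A u j 1 0 0; rewrite scaler0 addr0 mul1r.
  by move/eqP; rewrite -subr_eq subrr => /eqP.
pose cv i := c *: v i.
suff mixE m : (m <= r.-1.+1)%N -> multiRform A (mix m v cv) = c ^+ m * multiRform A v.
  by rewrite -mixE// mix_full.
elim: m => [_|m IHm mr]; first by rewrite mix0 expr0 mul1r.
rewrite (mixS mr) -[cv _]addr0 multiRform_linear form0 addr0 -mix_dfwith.
by rewrite IHm 1?ltnW// exprS mulrA.
Qed.

Context (A : multiPop r P) (q D : R).
Hypotheses (q1 : 1 < q) (symA : symmetric_multiPop A).
Hypothesis AD : forall f : 'I_r.-1 -> Linf P,
  (forall i, \forall x \ae P, `|f i x| <= 1) ->
  (\int[P]_x (`|A f x| `^ q)%:E <= D%:E)%E.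

(* Symmetry moves slot j to the slot that multiplies A, where only its L^1 norm
   and its sup bound matter; this is what makes the exponent p irrelevant. *)
Lemma ler_norm_multiRform v j (K c : R) : 0 < K -> 0 <= c ->
    (forall i, i != j -> \forall x \ae P, `|v i x| <= 1) ->
    (\forall x \ae P, `|v j x| <= c) ->
  `|multiRform A v| <= K * \int[P]_x `|v j x| + c * (D / K `^ (q - 1)).
Proof.
move=> K0 c0 v1 vc.
have /(congr1 fine) := symA v (tperm j ord_max).
rewrite !multiPformE => /= ->; rewrite /multiRform /= tpermR.
apply: (Rintegral_moment_le q1) => //.
apply: AD => i; apply: v1.
by rewrite -{2}(tpermR j ord_max) (inj_eq perm_inj) eq_sym neq_lift.
Qed.

Lemma ler_dist_multiRform u w (K : R) : 0 < K ->
    (forall i, \forall x \ae P, `|u i x| <= 1) ->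
    (forall i, \forall x \ae P, `|w i x| <= 1) ->
  `|multiRform A u - multiRform A w| <=
  \sum_j (K * \int[P]_x `|u j x - w j x| + 2 * (D / K `^ (q - 1))).
Proof.
move=> K0 u1 w1.
pose F m := multiRform A (mix m u w).
have -> : multiRform A u - multiRform A w = \sum_(j < r.-1.+1) (F j - F j.+1).
  rewrite -opprB -[in LHS](mix_full u w) -{2}[u](mix0 u w) -/(F _) -/(F _).
  rewrite -(telescope_sumr _ (leq0n _)) big_mkord -sumrN.
  by apply: eq_bigr => j _; rewrite opprB.
apply: le_trans (ler_norm_sum _ _ _) _; apply: ler_sum => -[m mr] _.
(* Consecutive hybrids differ in one slot, so their difference is a single form with [u j - w j]
   there. That entry is bounded by 2, whence the constant 2. *)
rewrite /F (mixS mr) {1}(mix_dfwith mr) addrC -[- multiRform _ _]mulN1r -multiRform_linear.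
set v := dfwith _ _ _; set j := Ordinal mr.
have vj : v j = -1 *: w j + u j by rewrite /v dfwithin.
have vjE x : v j x = u j x - w j x by rewrite vj /= scaleN1r addrC.
rewrite (_ : \int[P]_x _ = \int[P]_x `|v j x|); last first.
  by apply: eq_Rintegral => x _; rewrite vjE.
apply: ler_norm_multiRform => //.
- move=> i ij; rewrite /v dfwithout 1?eq_sym// /mix.
  by case: ifP => _.
- apply: filterS2 (u1 j) (w1 j) => x ux wx.
  by rewrite vjE (le_trans (ler_normB _ _))// lerD.
Qed.

End FormBounds.

(** * Quantities that are read off the law of a profile vector *)

Section ProfileVector.
Context (R : realType) (r k : nat).
Context d (T : measurableType d) (P : probability T R) (A : multiPop r P).
Implicit Types f : 'I_k -> 'I_r.-1 -> Linf P.

Lemma tnth_profile_arg f x i j :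
  tnth (profile_vector A f x) (mxvec_index i (lift ord_max j)) = f i j x.
Proof. by rewrite tnth_mktuple mxvecE mxE liftK. Qed.

Lemma tnth_profile_val f x i :
  tnth (profile_vector A f x) (mxvec_index i ord_max) = A (f i) x.
Proof. by rewrite tnth_mktuple mxvecE mxE unlift_none. Qed.

End ProfileVector.

Section ProfileComparison.
Context (R : realType) (r k : nat).
Context d (T : measurableType d) (P : probability T R) (B : multiPop r P).
Context d' (T' : measurableType d') (P' : probability T' R) (A : multiPop r P').
Context (f : 'I_k -> 'I_r.-1 -> Linf P) (f' : 'I_k -> 'I_r.-1 -> Linf P') (e : R).
Hypotheses (f1 : forall i j, \forall x \ae P, `|f i j x| <= 1).
Hypotheses (f'1 : forall i j, \forall x \ae P', `|f' i j x| <= 1).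
Hypothesis ff'e : (dLP (distribution P (profile_vector B f))
                       (distribution P' (profile_vector A f')) < e%:E)%E.

(** The test function min(|t_a - t_b|, 2) has Lipschitz constant 2 and bound 2, whence 4 = 2 + 2;
    the cap at 2 is invisible on arguments bounded by 1. *)
Lemma profile_dist_args i j i' j' :
  \int[P]_x `|f i j x - f i' j' x| <=
  \int[P']_x `|f' i j x - f' i' j' x| + 4 * e.
Proof.
pose a : 'I_(k * r.-1.+1) := mxvec_index i (lift ord_max j).
pose b : 'I_(k * r.-1.+1) := mxvec_index i' (lift ord_max j').
pose g (t : (k * r.-1.+1).-tuple R) := Num.min `|tnth t a - tnth t b| 2.
have mg : measurable_fun setT g.
  apply: measurable_minr => //; apply: measurableT_comp => //.
  by apply: measurable_funB; exact: measurable_tnth.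
have g2 t : 0 <= g t <= 2 by rewrite le_min normr_ge0 ler0n ge_min lexx orbT.
have lipg s t : g s - g t <= 2 * eucl_dist s t.
  have := ler_eucl_dist s t a; have := ler_eucl_dist s t b.
  have : `|tnth s a - tnth s b| <=
      `|tnth s a - tnth t a| + `|tnth t a - tnth t b| + `|tnth s b - tnth t b|.
    rewrite (distrC (tnth s b)) -addrA (le_trans (ler_distD (tnth t a) _ _))//.
    by rewrite lerD2l ler_distD.
  have e0 : 0 <= eucl_dist s t by exact: sqrtr_ge0.
  by rewrite /g !minEle; case: ifPn; case: ifPn; rewrite -?ltNge; move=> *; lra.
have := dLP_lt_Rintegral mg g2 (ler0n R 2) lipg ff'e.
have gE d0 (T0 : measurableType d0) (P0 : probability T0 R) (C : multiPop r P0)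
    (h : 'I_k -> 'I_r.-1 -> Linf P0) :
    (forall i j, \forall x \ae P0, `|h i j x| <= 1) ->
    \int[P0]_x g (profile_vector C h x) = \int[P0]_x `|h i j x - h i' j' x|.
  move=> h1; apply: ae_eq_Rintegral.
  - exact: measurableT_comp.
  - by apply: measurableT_comp => //; exact: measurable_funB.
  apply: filterS2 (h1 i j) (h1 i' j') => x h1x h2x.
  rewrite /g !tnth_profile_arg min_l// (le_trans (ler_normB _ _))//; lra.
by rewrite !gE// ler_norml => /andP[_]; lra.
Qed.

(** The test function is a product of clips, at K for the value and at 1 for the argument. Adding K
    makes it nonnegative with bound 2K; its Lipschitz constant is 1 + K, and the sum is 1 + 3K. The
    tails pay for the truncation on either side. *)
Lemma profile_dist_form (K tl tl' : R) i i' j' : 0 < K ->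
    P.-integrable setT (EFin \o B (f i)) ->
    \int[P]_x `|B (f i) x - clip K (B (f i) x)| <= tl ->
    \int[P']_x `|A (f' i) x - clip K (A (f' i) x)| <= tl' ->
  `|\int[P]_x (B (f i) x * f i' j' x) - \int[P']_x (A (f' i) x * f' i' j' x)| <=
  tl + tl' + (1 + 3 * K) * e.
Proof.
move=> K0 intB Btl Atl.
pose a : 'I_(k * r.-1.+1) := mxvec_index i ord_max.
pose b : 'I_(k * r.-1.+1) := mxvec_index i' (lift ord_max j').
pose h (t : (k * r.-1.+1).-tuple R) := clip K (tnth t a) * clip 1 (tnth t b).
have mh : measurable_fun setT h.
  by apply: measurable_funM; apply: measurableT_comp (measurable_clip _) _;
    exact: measurable_tnth.
have hK t : `|h t| <= K.
  rewrite normrM -[leRHS]mulr1 ler_pM ?ler_norm_clip//; exact: ltW.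
pose g t := h t + K.
have mg : measurable_fun setT g by exact: measurable_funD.
have g2 t : 0 <= g t <= 2 * K.
  by have := hK t; rewrite ler_norml => /andP[*]; apply/andP; rewrite /g; split; lra.
have lipg s t : g s - g t <= (1 + K) * eucl_dist s t.
  have -> : g s - g t = (clip K (tnth s a) - clip K (tnth t a)) * clip 1 (tnth s b)
      + clip K (tnth t a) * (clip 1 (tnth s b) - clip 1 (tnth t b)).
    by rewrite /g /h; ring.
  rewrite (le_trans (ler_norm _))// (le_trans (ler_normD _ _))// [leRHS]mulrDl mul1r.
  rewrite !normrM lerD//.
    rewrite -[leRHS]mulr1 ler_pM ?ler_norm_clip//.
    by rewrite (le_trans (ler_dist_clip _ _ (ltW K0)))// ler_eucl_dist.
  rewrite ler_pM ?ler_norm_clip ?(ltW K0)//.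
  by rewrite (le_trans (ler_dist_clip _ _ ler01))// ler_eucl_dist.
have gE d0 (T0 : measurableType d0) (P0 : probability T0 R)
    (X : {RV P0 >-> (k * r.-1.+1).-tuple R}) :
    \int[P0]_x g (X x) = \int[P0]_x h (X x) + K.
  rewrite /g RintegralD//; last 2 first.
  - apply: (@integrable_ae_bounded _ _ _ _ _ K); first exact: measurableT_comp.
    by apply: aeW => x; exact: hK.
  - exact: finite_measure_integrable_cst.
  by rewrite Rintegral_cst//= probability_setT mulr1.
have lawdist := dLP_lt_Rintegral mg g2 (addr_ge0 ler01 (ltW K0)) lipg ff'e.
have hE d0 (T0 : measurableType d0) (P0 : probability T0 R) (C : multiPop r P0)
    (u : 'I_k -> 'I_r.-1 -> Linf P0) :
    \int[P0]_x h (profile_vector C u x) =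
    \int[P0]_x (clip K (C (u i) x) * clip 1 (u i' j' x)).
  by apply: eq_Rintegral => x _; rewrite /h tnth_profile_arg tnth_profile_val.
have Bdist := Rintegral_clip_dist (ltW K0) intB (measurable_funPT (f i' j')) (f1 i' j').
have Adist := Rintegral_clip_dist (ltW K0) (L1_integrable (A (f' i)))
  (measurable_funPT (f' i' j')) (f'1 i' j').
move: lawdist (le_trans Bdist Btl) (le_trans Adist Atl); rewrite !gE !hE.
by rewrite !ler_norml => /andP[? ?] /andP[? ?] /andP[? ?]; apply/andP; split; lra.
Qed.

End ProfileComparison.

(** * Transfer of approximate symmetry through close 3-profiles *)

Lemma dH_lt_dLP (R : realType) (n : nat)
    (X Y : set (probability (n.-tuple R) R)) y (e : \bar R) :
  Y y -> (dH X Y < e)%E -> exists2 x, X x & (dLP x y < e)%E.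
Proof.
move=> Yy; rewrite /dH gt_max => /andP[_ supe].
have /ereal_inf_lt[_ [x Xx <-] xye] : (ereal_inf [set dLP x y | x in X] < e)%E.
  by apply: le_lt_trans supe; apply: ereal_sup_ubound; exists y.
by exists x.
Qed.

Section SymmetryOfLimit.
Context (R : realType) (r : nat).
Context d (T : measurableType d) (P : probability T R) (B : multiPop r P).
Context d' (T' : measurableType d') (P' : probability T' R) (A : multiPop r P').
Context (q D : R).
Hypotheses (q1 : 1 < q) (symB : symmetric_multiPop B).
Hypothesis BD : forall f : 'I_r.-1 -> Linf P,
  (forall i, \forall x \ae P, `|f i x| <= 1) ->
  (\int[P]_x (`|B f x| `^ q)%:E <= D%:E)%E.

(* The three rows of the profile are the arguments of the two forms and the
   constant row v_r, which makes v_r visible to the law. *)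
Lemma profile_close_symmetric (j0 : 'I_r.-1) (v : 'I_r.-1.+1 -> Linf P')
    (s : {perm 'I_r.-1.+1}) (K e tl : R) :
    (forall i, \forall x \ae P', `|v i x| <= 1) -> 0 < K -> 0 < e ->
    (forall v', v' = v \/ v' = v \o s ->
      let Av := A (fun i => v' (lift ord_max i)) in
      \int[P']_x `|Av x - clip K (Av x)| <= tl) ->
    (dH (profile B 3) (profile A 3) < e%:E)%E ->
  `|multiRform A v - multiRform A (v \o s)| <=
  2 * (D / K `^ (q - 1) + tl + (1 + 3 * K) * e) +
  r.-1.+1%:R * (K * (4 * e) + 2 * (D / K `^ (q - 1))).
Proof.
move=> v1 K0 e0 Atl dHe.
pose f' (i : 'I_3) (j : 'I_r.-1) : Linf P' :=
  match val i with
  | 0%N => v (lift ord_max j) | 1%N => v (s (lift ord_max j)) | _ => v ord_max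
  end.
have f'1 i j : \forall x \ae P', `|f' i j x| <= 1.
  by rewrite /f'; case: (val i) => [|[|_]]; exact: v1.
have [_ [f fI <-] ff'] : exists2 mu, profile B 3 mu &
    (dLP mu (distribution P' (profile_vector A f')) < e%:E)%E.
  apply: dH_lt_dLP dHe; exists f' => // i j.
  by apply: filterS (f'1 i j) => x; rewrite ler_norml.
have f1 i j : \forall x \ae P, `|f i j x| <= 1.
  by apply: filterS (fI i j) => x; rewrite ler_norml.
pose row1 : 'I_3 := lift ord0 ord0; pose row2 : 'I_3 := ord_max.
(* [pos i] is a place of the profile that holds slot [i] of [v]. Row 2 of [f'] is constant, so any
   column [j0] gives the last slot. *)
pose pos (i : 'I_r.-1.+1) : 'I_3 * 'I_r.-1 :=
  if unlift ord_max i is Some j then (ord0, j) else (row2, j0).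
have f'pos i : f' (pos i).1 (pos i).2 = v i.
  by rewrite /pos; case: unliftP => [j|] ->.
(* [u] imitates [v], and [w] imitates [v \o s] with the arguments of the second row. The last entry
   of [w] is taken from [u], so [w] and [u \o s] agree there exactly. *)
pose u i := f (pos i).1 (pos i).2.
pose w i := if unlift ord_max i is Some j then f row1 j else u (s i).
have u1 i : \forall x \ae P, `|u i x| <= 1 by exact: f1.
have w1 i : \forall x \ae P, `|w i x| <= 1.
  by rewrite /w; case: unliftP => [j _|_]; exact: f1.
have Btl i : \int[P]_x `|B (f i) x - clip K (B (f i) x)| <= D / K `^ (q - 1).
  by apply: Rintegral_tail_moment => //; exact: BD.
have uA : `|multiRform B u - multiRform A v| <= D / K `^ (q - 1) + tl + (1 + 3 * K) * e.
  have ul : (fun i => u (lift ord_max i)) = f ord0.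
    by apply/funext => i; rewrite /u /pos liftK.
  have := profile_dist_form f1 f'1 ff' (pos ord_max).1 (pos ord_max).2 K0
    (L1_integrable (B (f ord0))) (Btl ord0) (Atl v (or_introl erefl)).
  by rewrite f'pos /multiRform ul.
have wA : `|multiRform B w - multiRform A (v \o s)| <=
    D / K `^ (q - 1) + tl + (1 + 3 * K) * e.
  have wl : (fun i => w (lift ord_max i)) = f row1.
    by apply/funext => i; rewrite /w liftK.
  have wm : w ord_max = u (s ord_max) by rewrite /w unlift_none.
  have := profile_dist_form f1 f'1 ff' (pos (s ord_max)).1 (pos (s ord_max)).2 K0
    (L1_integrable (B (f row1))) (Btl row1) (Atl (v \o s) (or_intror erefl)).
  by rewrite f'pos /multiRform wl wm.
have usw : `|multiRform B (u \o s) - multiRform B w| <=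
    r.-1.+1%:R * (K * (4 * e) + 2 * (D / K `^ (q - 1))).
  apply: le_trans (ler_dist_multiRform q1 symB BD K0 _ w1) _; first by move=> i; exact: u1.
  rewrite [leRHS](_ : _ = \sum_(i < r.-1.+1) (K * (4 * e) + 2 * (D / K `^ (q - 1)))).
    apply: ler_sum => i _; rewrite lerD2r ler_wpM2l ?(ltW K0)// /= /w.
    case: unliftP => [j ij|_]; last first.
      rewrite (_ : \int[P]_x _ = 0); first by rewrite mulr_ge0// ltW.
      rewrite -[RHS](mul0r (fine (P setT))) -Rintegral_cst//.
      by apply: eq_Rintegral => x _; rewrite subrr normr0.
    (* On the side of [A] both places hold the same function [v (s i)], so their L^1 distance is 0
       there and at most 4e on the side of [B]. *)
    have := profile_dist_args f1 f'1 ff' (pos (s i)).1 (pos (s i)).2 row1 j.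
    rewrite f'pos /f' /= -ij (_ : \int[P']_x _ = 0) ?add0r//.
    rewrite -[RHS](mul0r (fine (P' setT))) -Rintegral_cst//.
    by apply: eq_Rintegral => x _; rewrite subrr normr0.
  by rewrite sumr_const card_ord mulr_natl.
(* Exact symmetry of [B] links the chain A v, B u, B (u o s), B w, A (v o s). *)
have us : multiRform B (u \o s) = multiRform B u.
  by have /(congr1 fine) := symB u s; rewrite !multiPformE.
rewrite us in usw.
move: uA wA usw; rewrite !ler_norml.
by move=> /andP[? ?] /andP[? ?] /andP[? ?]; apply/andP; split; lra.
Qed.

End SymmetryOfLimit.
(** Dividing all slots by one common constant, the sum of their sup bounds, makes them bounded by 1
    and multiplies both forms by the same power. *)
Lemma symmetric_multiPop_of_bounded (R : realType) (r : nat) d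
    (T : measurableType d) (P : probability T R) (A : multiPop r P) :
    (forall (v : 'I_r.-1.+1 -> Linf P) (s : {perm 'I_r.-1.+1}),
      (forall i, \forall x \ae P, `|v i x| <= 1) ->
      multiRform A v = multiRform A (v \o s)) ->
  symmetric_multiPop A.
Proof.
move=> symA v s; rewrite !multiPformE; congr EFin.
have /choice[c cv] i : exists c : R, 0 < c /\ \forall x \ae P, `|v i x| <= c.
  by have [c c0 vc] := Linf_ae_bounded (v i); exists c.
have c_le i : c i <= \sum_j c j.
  by rewrite (bigD1 i)//= lerDl sumr_ge0// => j _; exact/ltW/(cv j).1.
pose k := \sum_j c j.
have k0 : 0 < k by apply: lt_le_trans (c_le ord_max); exact: (cv _).1.
pose u i := k^-1 *: v i.
have vE : v = fun i => k *: u i.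
  by apply/funext => i; rewrite /u scalerA divff ?scale1r// gt_eqF.
have vsE : v \o s = fun i => k *: (u \o s) i by rewrite [in LHS]vE.
rewrite vsE [in LHS]vE (multiRformZ A u) (multiRformZ A (u \o s)) (symA u s)// => i.
apply: filterS (cv i).2 => x vxc.
rewrite /u /= normrZ gtr0_norm ?invr_gt0// mulrC ler_pdivrMr// mul1r.
exact: le_trans (c_le i).
Qed.

Lemma near_tail_le (R : realType) (q D e : R) : 1 < q -> 0 <= D -> 0 < e ->
  \forall n \near \oo, D / n.+1%:R `^ (q - 1) <= e.
Proof.
move=> q1 D0 e0; have q10 : 0 < q - 1 by lra.
near=> n.
(* This threshold solves D / x^(q - 1) = e for x when D > 0. *)
have Dn : (D / e) `^ (q - 1)^-1 <= n.+1%:R.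
  rewrite (le_trans (ltW (archi_boundP (powR_ge0 _ _))))// ler_nat leqW//.
  by near: n; exact: nbhs_infty_ge.
rewrite ler_pdivrMr ?powR_gt0// mulrC -ler_pdivrMr//.
have -> : D / e = ((D / e) `^ (q - 1)^-1) `^ (q - 1).
  by rewrite -powRrM mulVf ?gt_eqF// powRr1// divr_ge0// ltW.
by rewrite ge0_ler_powR ?nnegrE ?powR_ge0// ltW.
Unshelve. all: by end_near. Qed.

Theorem lemma7p4 (R : realType) (r : nat) (hr : (2 <= r)%N)
    (p : \bar R) (hp : (1 <= p)%E) (q : R) (hq : 1 < q)
    (d : nat -> measure_display) (T : forall i : nat, measurableType (d i))
    (P : forall i : nat, probability (T i) R)
    (A : forall i : nat, multiPop r (P i))
    (hbounded : (ereal_sup (range (fun i : nat => opnorm p q%:E (A i))) < +oo)%E)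
    (d' : measure_display) (T' : measurableType d') (P' : probability T' R)
    (A' : multiPop r P')
    (hconv : action_convergent A A')
    (hsym : forall i : nat, symmetric_multiPop (A i)) :
  symmetric_multiPop A'.
Proof.
have q0 : 0 < q by lra.
have [C C0 AC] : exists2 C : R, 0 <= C & forall i, (opnorm p q%:E (A i) <= C%:E)%E.
  have Ale i : (opnorm p q%:E (A i) <= ereal_sup (range (fun i => opnorm p q%:E (A i))))%E.
    by apply: ereal_sup_ubound; exists i.
  (* The supremum lives in the extended reals: a finite value is raised to be nonnegative, and for
     -oo the constant 0 serves. *)
  case: ereal_sup hbounded Ale => [C _ AC|//|_ AC].
    exists (Num.max 0 C); first by rewrite le_max lexx.
    by move=> i; rewrite (le_trans (AC i))// lee_fin le_max lexx orbT.
  by exists 0 => // i; rewrite (le_trans (AC i))// leNye.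
pose D := C `^ q.
have AD i (f : 'I_r.-1 -> Linf (P i)) : (forall j, \forall x \ae P i, `|f j x| <= 1) ->
    (\int[P i]_x (`|A i f x| `^ q)%:E <= D%:E)%E.
  exact: multiPop_moment hp hq C0 (AC i).
have r0 : (0 < r.-1)%N by rewrite -subn1 subn_gt0.
apply: symmetric_multiPop_of_bounded => v s v1.
apply/eqP; rewrite -subr_eq0 -normr_le0; apply/ler_addgt0Pr => eta eta0; rewrite add0r.
(* Each of the two form comparisons costs at most 3 [dl], counted twice in all, and each of the
   [r.-1.+1] slots costs 3 [dl]. *)
pose dl := eta / (6 + 3 * r.-1.+1%:R).
have N0 : 0 < 6 + 3 * r.-1.+1%:R :> R by rewrite addr_gt0// mulr_gt0.
have dl0 : 0 < dl by rewrite divr_gt0.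
have near_tail (v' : 'I_r.-1.+1 -> Linf P') : \forall n \near \oo,
    \int[P']_x `|A' (fun i => v' (lift ord_max i)) x -
      clip n.+1%:R (A' (fun i => v' (lift ord_max i)) x)| <= dl.
  have := cvg_Rintegral_tail (L1_integrable (A' (fun i => v' (lift ord_max i)))).
  by move=> /cvgr_le; apply.
near \oo => n.
pose K : R := n.+1%:R.
have K0 : 0 < K by rewrite ltr0n.
(* The order of choice matters: [K] controls the tails, then [e] depends on [K], then [i] on [e].
   Since 1 + 7K = (1 + 3K) + 4K, both (1 + 3K)e and 4Ke are at most [dl]. *)
pose e := dl / (1 + 7 * K).
have e0 : 0 < e by rewrite divr_gt0// addr_gt0// mulr_gt0.
have [i dHe] : exists i, (dH (profile (A i) 3) (profile A' 3) < e%:E)%E.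
  have /(_ [set y | y < e%:E]%E) := hconv.2 3%N isT.
  case=> [|m _ /(_ m (leqnn m))]; last by exists m.
  by apply: open_nbhs_nbhs; split; [exact: open_ereal_lt_ereal|rewrite /= lte_fin].
have := @profile_close_symmetric _ _ _ _ _ (A i) _ _ _ A' q D hq (hsym i) (@AD i)
  (Ordinal r0) v s K e dl v1 K0 e0.
have vtail : \int[P']_x `|A' (fun i => v (lift ord_max i)) x -
    clip K (A' (fun i => v (lift ord_max i)) x)| <= dl.
  by rewrite /K; near: n; exact: near_tail.
have vstail : \int[P']_x `|A' (fun i => (v \o s) (lift ord_max i)) x -
    clip K (A' (fun i => (v \o s) (lift ord_max i)) x)| <= dl.
  by rewrite /K; near: n; exact: near_tail.
have KD : D / K `^ (q - 1) <= dl.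
  by rewrite /K; near: n; apply: near_tail_le => //; exact: powR_ge0.
move=> /(_ _ dHe) close; apply: le_trans (close _) _.
  by move=> v' [] ->.
have Ke : (1 + 7 * K) * e = dl by rewrite /e mulrC divfK// gt_eqF// addr_gt0// mulr_gt0.
have etaE : eta = 6 * dl + r.-1.+1%:R * (3 * dl).
  have <- : (6 + 3 * r.-1.+1%:R) * dl = eta by rewrite mulrC divfK// gt_eqF.
  by ring.
have Ke0 : 0 <= K * e by rewrite mulr_ge0 ?ltW.
rewrite etaE lerD//; first by lra.
by rewrite ler_wpM2l//; lra.
Unshelve. all: by end_near. Qed.
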